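(* Let $k\ge0$ be an integer, let $p\in[0,1]$ with $p\ge p_{sh}^{\mathbb{Z}_{(k)}}=1-\frac{k^k}{(k+1)^{k+1}}$, and let $\xi$ be the unique solution in $[\frac{k}{k+1},1]$ of $\xi^k(1-\xi)=1-p$. Let $X=\{X_n\}_{n\in\mathbb{Z}}$ be i.i.d. Bernoulli random variables with $\mathbb{P}(X_n=1)=\xi$, and define $Z=\{Z_n\}_{n\in\mathbb{Z}}$ by $$\forall n\in\mathbb{Z}:\quad Z_n:=1-(1-X_n)\prod_{i=1}^{k}X_{n-i}.$$ Then $Z$ is distributed according to Shearer's measure $\mu_{\mathbb{Z}_{(k)},p}$ on the $k$-fuzz $\mathbb{Z}_{(k)}$ of $\mathbb{Z}$.
   Context: Conventions: $0^0:=1$, empty products are $1$. $\mathbb{Z}_{(k)}$ is the graph with vertex set $\mathbb{Z}$ and edges between all pairs of distinct integers at distance at most $k$. Shearer's measure. For a finite graph $G=(V,E)$, $p\in[0,1]$ and $q=1-p$, the signed measure $\mu_{G,p}$ on $\{0,1\}^V$ is defined (with coordinate process $Y$) by $$\mu_{G,p}(Y_B=\vec 0,Y_{V\setminus B}=\vec 1):=\sum_{B\subseteq T\subseteq V,\ T\text{ independent}}(-1)^{|T|-|B|}q^{|T|}\qquad(B\subseteq V),$$ where a set of vertices is independent iff it contains no two adjacent vertices; equivalently $\mu_{G,p}(Y_B=\vec0)=q^{|B|}$ if $B$ is independent and $0$ otherwise. Let $\Xi_G(p):=\mu_{G,p}(Y_V=\vec1)=\sum_{T\text{ independent}}(-q)^{|T|}$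 and $p_{sh}^G:=\max\{p:\Xi_G(p)\le0\}=\min\{p:\mu_{G,p}\text{ is a probability measure}\}$. For an infinite graph $G$, $p_{sh}^G:=\sup\{p_{sh}^H:H\text{ finite subgraph of }G\}$, and for $p\ge p_{sh}^G$, $\mu_{G,p}$ is the unique probability measure on $\{0,1\}^V$ whose marginal on every finite $W\subseteq V$ is $\mu_{G(W),p}$, where $G(W)$ is the subgraph induced by $W$. *)

(* Defs.v *)
From HB Require Import structures.
From mathcomp Require Import all_boot all_order all_algebra finmap.
From mathcomp Require Import all_classical all_reals all_analysis.
Set Implicit Arguments.
Unset Strict Implicit.
Unset Printing Implicit Defensive.
Import Order.TTheory GRing.Theory Num.Theory.
Import numFieldNormedType.Exports.

Local Open Scope classical_set_scope.
Local Open Scope ring_scope.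

Record graph (V : Type) := Graph {
  adj :> rel V;
  adj_sym : symmetric adj;
  adj_irrefl : irreflexive adj }.

Definition is_subgraph (V : choiceType) (W : {fset V}) (H : graph W)
    (G : graph V) : Prop :=
  forall x y : W, H x y -> G (val x) (val y).

Lemma induced_sym (V : choiceType) (G : graph V) (W : {fset V}) :
  symmetric (fun x y : W => G (val x) (val y)).
Proof. by move=> x y; exact: adj_sym. Qed.

Lemma induced_irrefl (V : choiceType) (G : graph V) (W : {fset V}) :
  irreflexive (fun x y : W => G (val x) (val y)).
Proof. by move=> x; exact: adj_irrefl. Qed.

Definition induced (V : choiceType) (G : graph V) (W : {fset V}) : graph W :=
  Graph (induced_sym G (W := W)) (induced_irrefl G (W := W)).

Definition kfuzz_adj (k : nat) : rel int :=
  fun m n => (m != n) && (`|m - n| <= k%:Z).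

Lemma kfuzz_sym (k : nat) : symmetric (kfuzz_adj k).
Proof. by move=> m n; rewrite /kfuzz_adj eq_sym distrC. Qed.

Lemma kfuzz_irrefl (k : nat) : irreflexive (kfuzz_adj k).
Proof. by move=> m; rewrite /kfuzz_adj eqxx. Qed.

Definition kfuzz (k : nat) : graph int := Graph (@kfuzz_sym k) (@kfuzz_irrefl k).

Section finite_shearer.
Variables (R : realType) (V : finType) (G : graph V).

Definition independent (S : {set V}) : bool :=
  [forall x in S, forall y in S, ~~ G x y].

(* The mass of the single configuration y; B is the set of its zeros. *)
Definition shearer_mass (p : R) (y : {ffun V -> bool}) : R :=
  let q := 1 - p in
  let B := [set v | ~~ y v]%SET in
  \sum_(S : {set V} | (B \subset S) && independent S)
    (-1) ^+ (#|S| - #|B|) * q ^+ #|S|.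

Definition shearer_signed_measure (p : R) (A : {set {ffun V -> bool}}) : R :=
  \sum_(y in A) shearer_mass p y.

Definition shearer_Xi (p : R) : R :=
  shearer_signed_measure p [set [ffun=> true]]%SET.

(* The supremum is a maximum when V is nonempty. On the empty graph Xi is 1,
   and the value is sup set0 = 0, which is also the least p for which the
   signed measure is a probability. *)
Definition p_sh_fin : R :=
  sup [set p : R | 0 <= p <= 1 /\ shearer_Xi p <= 0].

End finite_shearer.

Definition p_sh (R : realType) (V : choiceType) (G : graph V) : R :=
  sup [set x : R | exists (W : {fset V}) (H : graph W),
    is_subgraph H G /\ x = p_sh_fin R H].

Definition cylinders (V : Type) : set (set (V -> bool)) :=
  [set C | exists v b, C = [set y | y v = b]].

(* {0,1}^V with the product sigma-algebra *)
Definition config (V : Type) := g_sigma_algebraType (@cylinders V).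

Definition has_shearer_marginals (R : realType) (V : choiceType) (G : graph V)
    (p : R) (mu : probability (config V) R) : Prop :=
  forall (W : {fset V}) (A : {set {ffun W -> bool}}),
    mu [set y : config V | [ffun v : W => y (val v)] \in A] =
    (shearer_signed_measure (induced G W) p A)%:E.

Definition is_shearer_measure (R : realType) (V : choiceType) (G : graph V)
    (p : R) (mu : probability (config V) R) : Prop :=
  has_shearer_marginals G p mu /\
  forall nu : probability (config V) R, has_shearer_marginals G p nu ->
    forall A : set (config V), measurable A -> nu A = mu A.

Definition mutually_independent d d' (T : measurableType d)
    (T' : measurableType d') (R : realType) (P : probability T R)
    (I : choiceType) (X : I -> {RV P >-> T'}) : Prop :=
  forall (J : {fset I}) (A : I -> set T'),
    (forall i, measurable (A i)) ->
    P (\bigcap_(i in [set` J]) X i @^-1` A i) =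
    (\prod_(i <- J) P (X i @^-1` A i))%E.

Definition iid_bernoulli d (T : measurableType d) (R : realType)
    (P : probability T R) (I : choiceType) (X : I -> {RV P >-> bool})
    (xi : R) : Prop :=
  mutually_independent X /\ forall i, P (X i @^-1` [set true]) = xi%:E.

Definition has_law d (T : measurableType d) (R : realType)
    (P : probability T R) (V : Type) (Z : V -> T -> bool)
    (mu : probability (config V) R) : Prop :=
  let Zpath : T -> config V := fun w v => Z v w in
  measurable_fun [set: T] Zpath /\
  forall A : set (config V), measurable A -> P (Zpath @^-1` A) = mu A.

(* Main.v *)
Require Import Defs.
From HB Require Import structures.
From mathcomp Require Import all_boot all_order all_algebra finmap.
From mathcomp Require Import all_classical all_reals all_analysis.
From mathcomp Require Import zify ring lra.
Set Implicit Arguments.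
Unset Strict Implicit.
Unset Printing Implicit Defensive.
Import Order.TTheory GRing.Theory Num.Theory.
Import numFieldNormedType.Exports.
Local Open Scope classical_set_scope.
Local Open Scope ring_scope.

(** Write [Xi A] for the independence polynomial of the subgraph induced on [A],
    evaluated at [-q], so that [Xi (A) = Xi (A - v) - q Xi (A - v - N(v))].  Let
    [q* = k^k / (k+1)^(k+1)], the maximum of [x^k (1 - x)] on [0, 1].

    If [q < q*], write [q = x^k (1 - x)] with [x > k/(k+1)].  Removing vertices from
    right to left, each removal increases [Xi] by a factor at most [1/x], whence
    [Xi > 0] for every finite subgraph of the k-fuzz.  If [q > q*], the values
    [b n] on n consecutive integers satisfy [b (n+1) = b n - q b (n-k)] and cannot
    all be positive.  This gives the critical value.

    [Z n = 0] means that [X] reads [1 ... 1 0] on [n-k, ..., n].  Two such events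
    at distance at most k are incompatible, and otherwise the blocks are
    disjoint, so [P (Z = 0 on S)] is [q^|S|] or 0 according to whether [S] is
    independent.  Moebius inversion then determines the finite marginals. *)

(** * The function x^k (1 - x) on [0, 1] *)

Section unimodal.
Variable R : realType.
Implicit Types (k : nat) (x y : R).

(** Convexity of the power function: a secant slope is at most the derivative at the right end. The
    companion [deriv_le_subX] bounds it below by the derivative at the left end. *)
Lemma subX_le_deriv k x y : 0 <= x -> x <= y ->
  y ^+ k.+1 - x ^+ k.+1 <= k.+1%:R * y ^+ k * (y - x).
Proof.
move=> x0 xy; have y0 := le_trans x0 xy.
elim: k => [|k IH]; first by rewrite !expr1 expr0; lra.
have xyk : x ^+ k.+1 <= y ^+ k.+1 by rewrite lerXn2r ?nnegrE.
have -> : y ^+ k.+2 - x ^+ k.+2 =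
    y * (y ^+ k.+1 - x ^+ k.+1) + x ^+ k.+1 * (y - x).
  by rewrite !(exprS _ k.+1); ring.
have := ler_wpM2l y0 IH.
have : x ^+ k.+1 * (y - x) <= y ^+ k.+1 * (y - x) by rewrite ler_wpM2r ?subr_ge0.
rewrite (_ : y * (k.+1%:R * y ^+ k * (y - x)) = k.+1%:R * y ^+ k.+1 * (y - x));
  last by rewrite exprS; ring.
by rewrite -[k.+2%:R]natr1; lra.
Qed.

Lemma deriv_le_subX k x y : 0 <= x -> x <= y ->
  k.+1%:R * x ^+ k * (y - x) <= y ^+ k.+1 - x ^+ k.+1.
Proof.
move=> x0 xy; have y0 := le_trans x0 xy.
elim: k => [|k IH]; first by rewrite !expr1 expr0; lra.
have -> : y ^+ k.+2 - x ^+ k.+2 =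
    x * (y ^+ k.+1 - x ^+ k.+1) + y ^+ k.+1 * (y - x).
  by rewrite !(exprS _ k.+1); ring.
have := ler_wpM2l x0 IH.
have : x ^+ k.+1 * (y - x) <= y ^+ k.+1 * (y - x).
  by rewrite ler_wpM2r ?subr_ge0 // lerXn2r ?nnegrE.
rewrite (_ : x * (k.+1%:R * x ^+ k * (y - x)) = k.+1%:R * x ^+ k.+1 * (y - x));
  last by rewrite exprS; ring.
by rewrite -[k.+2%:R]natr1; lra.
Qed.

Lemma mode_scaled k : k.+1%:R * (k%:R / k.+1%:R) = k%:R :> R.
Proof. by rewrite mulrC divfK // pnatr_eq0. Qed.

Lemma mode_itv k : 0 <= (k%:R / k.+1%:R : R) < 1.
Proof.
by rewrite divr_ge0 ?ler0n //= ltr_pdivrMr ?ltr0n // mul1r ltr_nat ltnSn.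
Qed.

Lemma mode_value k : (k%:R / k.+1%:R) ^+ k * (1 - k%:R / k.+1%:R) =
  k%:R ^+ k / k.+1%:R ^+ k.+1 :> R.
Proof.
have k0 : k.+1%:R != 0 :> R by rewrite pnatr_eq0.
have -> : 1 - k%:R / k.+1%:R = k.+1%:R^-1 :> R.
  by apply: (mulfI k0); rewrite mulrBr mode_scaled divff // mulr1 -natr1; ring.
by rewrite expr_div_n exprSr invfM mulrA.
Qed.

(** For exponent k + 1, being right of the mode gives (k + 1) (1 - x) <= x < y. With the tangent
    bound at [y], the loss in the factor 1 - x then outweighs the growth of the power. *)
Lemma unimodal_decreasing k x y : k%:R / k.+1%:R <= x -> x < y -> y <= 1 ->
  y ^+ k * (1 - y) < x ^+ k * (1 - x).
Proof.
case: k => [|k] ax xy y1; first by rewrite !expr0; lra.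
have /andP[a0 _] := mode_itv k.+1; have x0 := le_trans a0 ax.
have y0 : 0 < y by lra.
have kx : k.+1%:R * (1 - x) <= x.
  have := ler_wpM2l (ler0n R k.+2) ax.
  by rewrite mode_scaled -[k.+2%:R]natr1; lra.
have h := subX_le_deriv k x0 (ltW xy).
have yk : 0 < y ^+ k by rewrite exprn_gt0.
have := ler_wpM2l (_ : 0 <= 1 - x) h.
have : 0 < y ^+ k * ((y - x) * (y - k.+1%:R * (1 - x))).
  by rewrite !mulr_gt0 // subr_gt0 //; lra.
by rewrite !(exprS _ k) => h1 /(_ ltac:(lra)); lra.
Qed.

Lemma unimodal_max k x : 0 <= x <= 1 ->
  x ^+ k * (1 - x) <= k%:R ^+ k / k.+1%:R ^+ k.+1.
Proof.
move=> /andP[x0 x1]; rewrite -mode_value.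
have [xa|ax|->] := ltgtP x (k%:R / k.+1%:R); last by [].
  2: exact/ltW/unimodal_decreasing.
case: k xa => [|k] xa; first by rewrite mul0r in xa; lra.
set a := k.+1%:R / k.+2%:R in xa *.
have ka : k.+1%:R * (1 - a) = a.
  by have := mode_scaled k.+1; rewrite -/a -[k.+2%:R]natr1; lra.
have a1 : a < 1 by case/andP: (mode_itv k.+1).
have := ler_wpM2l (_ : 0 <= 1 - a) (deriv_le_subX k x0 (ltW xa)).
move=> /(_ ltac:(lra)).
rewrite (_ : _ * (_ * _) = (k.+1%:R * (1 - a)) * (x ^+ k * (a - x))); last by ring.
rewrite ka.
(* Left of the mode [a], the tangent bound at [x] leaves exactly this slack. *)
have : 0 <= x ^+ k * ((a - x) * (a - x)).
  by rewrite mulr_ge0 ?exprn_ge0 // mulr_ge0 // subr_ge0 ltW.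
by rewrite !(exprS x k); nra.
Qed.

Lemma unimodal_solution k (q : R) : 0 <= q <= k%:R ^+ k / k.+1%:R ^+ k.+1 ->
  exists2 x, k%:R / k.+1%:R <= x <= 1 & x ^+ k * (1 - x) = q.
Proof.
move=> /andP[q0 qs]; have /andP[a0 a1] := mode_itv k.
pose f : {poly R} := 'X^k * ('X - 1) + q%:P.
have fE x : f.[x] = q - x ^+ k * (1 - x) by rewrite /f !hornerE; ring.
have [] := @poly_ivt R f _ _ (ltW a1).
  by rewrite !fE mode_value subrr mulr0 subr0 q0 subr_le0 qs.
move=> x xab /rootP; rewrite fE => xq.
by exists x => //; lra.
Qed.

End unimodal.

(** * Independence polynomials and their positivity *)

Section independence_polynomial.
Variables (R : realType) (V : finType) (G : graph V) (q : R).
Implicit Types (A B S : {set V}) (u v : V).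

Definition indep_poly A : R :=
  \sum_(S : {set V} | (S \subset A) && independent G S) (- q) ^+ #|S|.

Definition non_nbrs A v : {set V} := [set u in A :\ v | ~~ G v u]%SET.

Lemma independentS A B :
  (A \subset B)%SET -> independent G B -> independent G A.
Proof.
move=> /fintype.subsetP AB /forall_inP iB; apply/forall_inP => x xA.
by apply/forall_inP => y yA; move/forall_inP: (iB x (AB x xA)); apply; apply: AB.
Qed.

Lemma independentU1 v S : v \notin S ->
  independent G (v |: S) = independent G S && [forall u in S, ~~ G v u].
Proof.
move=> vS; apply/idP/andP => [iv|[/forall_inP iS /forall_inP iv]].
  split; first exact: independentS (finset.subsetUr _ _) iv.
  apply/forall_inP => u uS.
  move/forall_inP: iv => /(_ v); rewrite setU11 => /(_ isT) /forall_inP.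
  by apply; rewrite setU1r.
apply/forall_inP => x; rewrite in_setU1 => /predU1P[->|xS];
  apply/forall_inP => y; rewrite in_setU1 => /predU1P[->|yS].
- by rewrite adj_irrefl.
- exact: iv.
- by rewrite adj_sym; exact: iv.
- by move/forall_inP: (iS x xS); apply.
Qed.

Lemma indep_poly0 : indep_poly finset.set0 = 1.
Proof.
rewrite /indep_poly (big_pred1 finset.set0) ?cards0 ?expr0 // => S.
rewrite finset.subset0 /=; case: eqP => // ->.
by apply/forall_inP => x; rewrite inE.
Qed.

(** Split the independent sets by whether they contain [v]; those that do are [v |: S] with [S]
    independent among the non-neighbours of [v]. *)
Lemma indep_polyD1 A v : v \in A ->
  indep_poly A = indep_poly (A :\ v) - q * indep_poly (non_nbrs A v).
Proof.
move=> vA; rewrite /indep_poly (bigID (fun S : {set V} => v \in S)) /= addrC.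
congr (_ + _).
  by apply: eq_bigl => S; rewrite finset.subsetD1 andbAC.
rewrite -mulNr big_distrr /=.
rewrite (reindex_onto (fun S : {set V} => v |: S) (fun S => S :\ v)); last first.
  by move=> S /andP[_ vS]; rewrite finset.setD1K.
apply: eq_big => [S|S /andP[_ /eqP vS]]; last first.
  have {}vS : v \notin S by rewrite -vS !inE eqxx.
  by rewrite cardsU1 vS exprS.
have [vS|vS] := boolP (v \in S).
  rewrite (_ : _ :\ v == S = false) ?andbF; last first.
    by apply/eqP => /setP /(_ v); rewrite !inE vS eqxx.
  apply/esym/negbTE; rewrite negb_and; apply/orP; left.
  apply/negP => /fintype.subsetP /(_ v vS).
  by rewrite !inE eqxx.
rewrite setU1K // eqxx andbT setU11 andbT independentU1 // finset.subUset.
rewrite finset.sub1set vA andTb [RHS]andbC andbCA; congr (_ && _).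
apply/andP/fintype.subsetP => [[/fintype.subsetP SA /forall_inP Gv] u uS|SA].
  rewrite !inE SA // Gv // !andbT; apply: contraNneq vS => <-; exact: uS.
split; first by apply/fintype.subsetP => u /SA; rewrite !inE; case/andP=> /andP[].
by apply/forall_inP => u /SA; rewrite !inE => /andP[].
Qed.

Hypothesis q0 : 0 <= q.

(** Restoring a vertex subtracts [q] times the value on its non-neighbours, which is nonnegative by
    hypothesis. *)
Lemma indep_poly_anti A B :
  (forall C : {set V}, C \subset B -> 0 <= indep_poly C) ->
  A \subset B -> indep_poly B <= indep_poly A.
Proof.
have [n] := ubnP #|B|; elim: n B => // n IH B nB B0 AB.
have [AeB|] := eqVneq A B; first by rewrite AeB.
rewrite finset.eqEsubset AB /= => /fintype.subsetPn[v vB vA].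
have sBv : B :\ v \subset B by rewrite finset.subD1set.
apply: (@le_trans _ _ (indep_poly (B :\ v))).
  rewrite (indep_polyD1 vB) lerBlDr lerDl mulr_ge0 // B0 //.
  by apply/fintype.subsetP => u; rewrite !inE => /andP[/andP[_ ->]].
apply: IH; first by rewrite (cardsD1 v B) vB in nB.
  by move=> C CB; apply: B0; exact: fintype.subset_trans CB sBv.
by rewrite finset.subsetD1 AB.
Qed.

Variables (k : nat) (h : V -> int).
Hypothesis h_inj : injective h.
Hypothesis h_adj : forall u v, G u v -> `|h u - h v| <= k%:Z.

Definition below A (m : int) : {set V} := [set u in A | h u < m]%SET.

(** A division-free form of the bound 1/xi on the increase caused by deleting the rightmost vertex
    along [h]. *)
Definition max_ratio (xi : R) A :=
  forall v, v \in A -> (forall u, u \in A -> h u <= h v) ->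
    xi * indep_poly (A :\ v) <= indep_poly A.

(** Moving the cutoff one integer to the left removes at most one vertex, as [h] is injective. A
    removal costs one factor [xi]; an empty site is harmless since [xi <= 1]. *)
Lemma below_ratio (xi : R) A (m : int) (i : nat) : 0 <= xi <= 1 ->
  (forall B, B \subset A -> 0 <= indep_poly B /\ max_ratio xi B) ->
  xi ^+ i * indep_poly (below A (m - i%:Z)) <= indep_poly (below A m).
Proof.
move=> /andP[xi0 xi1] IA.
have sub j : below A j \subset A.
  by apply/fintype.subsetP => u; rewrite inE => /andP[].
elim: i => [|i IH]; first by rewrite expr0 mul1r subr0.
apply: le_trans IH; rewrite exprSr -mulrA ler_wpM2l ?exprn_ge0 //.
set j := m - i%:Z; have -> : m - i.+1%:Z = j - 1 by rewrite /j; lia.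
have [u /andP[uA /eqP uj]|noj] := pickP (fun u => (u \in A) && (h u == j - 1)).
  have -> : below A (j - 1) = below A j :\ u.
    apply/setP => w; rewrite !inE -(inj_eq h_inj) uj.
    by case: (w \in A) => /=; [lia | rewrite andbF].
  apply: (IA _ (sub j)).2; first by rewrite !inE uA uj; lia.
  by move=> w; rewrite inE uj => /andP[_]; lia.
have -> : below A (j - 1) = below A j.
  apply/setP => w; rewrite !inE; have := noj w.
  by case: (w \in A) => //=; lia.
by rewrite ler_piMl // (IA _ (sub j)).1.
Qed.

(** Positivity and the ratio bound are proved together by induction on the size of [A]. Edges must
    be short but short pairs need not be edges, so non-induced subgraphs of the k-fuzz are
    covered. *)
Lemma indep_poly_gt0 (xi : R) A : 0 < xi <= 1 -> q <= xi ^+ k * (1 - xi) ->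
  0 < indep_poly A.
Proof.
move=> /andP[xi0 xi1] qxi.
suff: 0 < indep_poly A /\ max_ratio xi A by case.
have [n] := ubnP #|A|; elim: n A => // n IH A nA.
have mA : max_ratio xi A.
  move=> v vA vmax; rewrite (indep_polyD1 vA).
  have IAv B : B \subset A :\ v -> 0 < indep_poly B /\ max_ratio xi B.
    move=> BA; apply: IH; apply: leq_ltn_trans (subset_leq_card BA) _.
    by rewrite (cardsD1 v A) vA in nA.
  have IAv' B : B \subset A :\ v -> 0 <= indep_poly B /\ max_ratio xi B.
    by move=> /IAv[/ltW].
  have := @below_ratio xi (A :\ v) (h v) k _ IAv'.
  rewrite (ltW xi0) xi1 => /(_ isT).
  have -> : below (A :\ v) (h v) = A :\ v.
    apply/setP => u; rewrite !inE -(inj_eq h_inj).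
    by case uA : (u \in A) => /=; [have := vmax u uA; lia | rewrite andbF].
  move=> ratio.
  (* The non-neighbours of [v] include all vertices more than [k] to its left. Hence the subtracted
     term is at most [q] times the value there, which is at most [1 - xi] times the value on
     [A :\ v]. *)
  have /indep_poly_anti : forall C : {set V},
      C \subset non_nbrs A v -> 0 <= indep_poly C.
    move=> C CN; apply: (IAv' _ _).1; apply: fintype.subset_trans CN _.
    by apply/fintype.subsetP => u; rewrite !inE => /andP[].
  move=> /(_ (below (A :\ v) (h v - k%:Z))) anti.
  have {}anti : indep_poly (non_nbrs A v) <=
      indep_poly (below (A :\ v) (h v - k%:Z)).
    apply: anti; apply/fintype.subsetP => u; rewrite !inE => /andP[-> uv] /=.
    by apply/negP => /h_adj; lia.
  have N0 : 0 <= indep_poly (below (A :\ v) (h v - k%:Z)).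
    by apply: (IAv' _ _).1; apply/fintype.subsetP => u; rewrite inE => /andP[].
  have := ler_wpM2l q0 anti.
  have := ler_wpM2r N0 qxi.
  have := ler_wpM2l (_ : 0 <= 1 - xi) ratio.
  by move=> /(_ ltac:(lra)); lra.
split=> //.
have [->|/set0Pn[v0 v0A]] := eqVneq A finset.set0; first by rewrite indep_poly0.
have [v vA vmax] := @arg_maxP _ _ _ v0 (mem A) h v0A.
have {}vA : v \in A := vA.
apply: lt_le_trans (mA v vA vmax); rewrite mulr_gt0 //; apply: (IH _ _).1.
by rewrite (cardsD1 v A) vA in nA.
Qed.

End independence_polynomial.

Lemma shearer_XiE (R : realType) (V : finType) (G : graph V) (p : R) :
  shearer_Xi G p = indep_poly G (1 - p) finset.setT.
Proof.
rewrite /shearer_Xi /shearer_signed_measure finset.big_set1 /shearer_mass.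
set B := [set v | _]%SET; have -> : B = finset.set0.
  by apply/setP => v; rewrite !inE ffunE.
rewrite cards0; apply: eq_big => [S|S _]; first by rewrite finset.sub0set finset.subsetT.
by rewrite subn0 [RHS]exprNn.
Qed.

(** * Independence polynomials of integer segments *)

Section segments.
Variables (R : realType) (k : nat) (q : R).

Definition segment (n : nat) : {fset int} :=
  [fset x in map Posz (iota 0 n)]%fset.

Lemma in_segment n (x : int) : (x \in segment n) = (0 <= x < n%:Z).
Proof.
rewrite in_fset /=; apply/mapP/idP => [[i + ->]|xn].
  by rewrite mem_iota; lia.
by exists `|x|%N; [rewrite mem_iota; lia | lia].
Qed.

Definition prefix n (m : nat) : {set segment n} :=
  [set v : segment n | val v < m%:Z]%SET.

Definition segment_poly n : R :=
  indep_poly (Defs.induced (kfuzz k) (segment n)) q finset.setT.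

(* For [m < k] the truncated [m - k] makes the last prefix empty, as needed. *)
Lemma prefix_polyS n m : (m < n)%N ->
  let Xi := indep_poly (Defs.induced (kfuzz k) (segment n)) q in
  Xi (prefix n m.+1) = Xi (prefix n m) - q * Xi (prefix n (m - k)).
Proof.
move=> mn Xi.
have mS : m%:Z \in segment n by rewrite in_segment; lia.
pose v : segment n := [` mS]%fset.
rewrite /Xi (indep_polyD1 _ _ (v := v)); last by rewrite inE /=; lia.
have -> : prefix n m.+1 :\ v = prefix n m.
  by apply/setP => u; rewrite !inE -val_eqE /=; lia.
congr (_ - q * indep_poly _ _ _); apply/setP => u.
have := valP u; rewrite in_segment !inE -val_eqE /= /kfuzz_adj => /andP[x0 _].
move: (fsval u) x0 => x x0.
have [xm|xm] := ltP x m%:Z; last by lia.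
have -> : x != m%:Z by lia.
have -> : m%:Z != x by lia.
have -> : x < m.+1%:Z by lia.
by rewrite /= -ltNge; lia.
Qed.

Lemma prefix_full n : prefix n n = finset.setT.
Proof. by apply/setP => u; have := valP u; rewrite in_segment !inE /=; lia. Qed.

(** The two sides live on different vertex types but satisfy the same recursion in [m] with the same
    initial value, so no graph isomorphism is needed. *)
Lemma prefix_polyE n m : (m <= n)%N ->
  indep_poly (Defs.induced (kfuzz k) (segment n)) q (prefix n m) = segment_poly m.
Proof.
elim/ltn_ind: m n => -[|m] IH n mn.
  rewrite /segment_poly -prefix_full.
  have prefix0 n' : prefix n' 0 = finset.set0.
    by apply/setP => u; have := valP u; rewrite in_segment !inE /=; lia.
  by rewrite !prefix0 !indep_poly0.
by rewrite /segment_poly -prefix_full !prefix_polyS // !IH //; lia.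
Qed.

Lemma segment_polyS n :
  segment_poly n.+1 = segment_poly n - q * segment_poly (n - k).
Proof.
by rewrite {1}/segment_poly -prefix_full prefix_polyS // !prefix_polyE //; lia.
Qed.

(* Were all values positive, an upper bound [c <= 1] on the ratio of
   successive values from some rank on would improve to [1 - q / c ^+ k], which
   is at most [c] minus the excess of [q] over [max_x x ^+ k * (1 - x)]. *)
Lemma segment_poly_le0 : k%:R ^+ k / k.+1%:R ^+ k.+1 < q ->
  exists n, segment_poly n <= 0.
Proof.
set qs := _ / _ => qsq.
apply: contrapT => /forallNP b_gt0.
have {}b_gt0 n : 0 < segment_poly n by rewrite ltNge; exact/negP.
have q_gt0 : 0 < q by apply: le_lt_trans qsq; rewrite divr_ge0 // exprn_ge0.
pose d := q - qs; have d0 : 0 < d by rewrite subr_gt0.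
have ratio j : 0 < 1 - j%:R * d /\ forall n, (j * k <= n)%N ->
    segment_poly n.+1 <= (1 - j%:R * d) * segment_poly n.
  have pos c : (forall n, (c.1 <= n)%N ->
      segment_poly n.+1 <= c.2 * segment_poly n) -> 0 < c.2.
    move=> /(_ c.1 (leqnn _)) /(lt_le_trans (b_gt0 _)).
    by rewrite pmulr_lgt0.
  elim: j => [|j [c_gt0 IH]].
    split=> [|n _]; first by rewrite mul0r subr0.
    rewrite mul0r subr0 mul1r segment_polyS.
    by rewrite gerDl oppr_le0 mulr_ge0 // ltW.
  set c := 1 - j%:R * d in c_gt0 IH.
  have cS : 1 - j.+1%:R * d = c - d by rewrite /c -natr1; ring.
  have c1 : c <= 1 by rewrite /c gerDl oppr_le0 mulr_ge0 // ltW.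
  suff H n : (j.+1 * k <= n)%N ->
      segment_poly n.+1 <= (1 - j.+1%:R * d) * segment_poly n.
    by split=> //; exact: (pos (_, _) H).
  move=> jn; rewrite cS.
  (* As [j.+1 * k <= n], the ratio bound [c] already holds on each of the [k] steps leading up to
     [n]. *)
  have pw i : (i <= k)%N ->
      segment_poly (n - k + i) <= c ^+ i * segment_poly (n - k).
    elim: i => [|i IHi] ik; first by rewrite addn0 mul1r.
    rewrite addnS exprS -mulrA.
    apply: le_trans (IH _ _) _; first by lia.
    by rewrite ler_wpM2l ?(ltW c_gt0) // IHi // ltnW.
  have := pw k (leqnn k); rewrite subnK; last by lia.
  move=> bn.
  have ck : 0 < c ^+ k by rewrite exprn_gt0.
  have ck1 : c ^+ k <= 1 by rewrite exprn_ile1 // ltW.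
  have cm : c ^+ k * (1 - c) <= qs by apply: unimodal_max; rewrite (ltW c_gt0).
  (* After multiplication by [c ^+ k], what remains is c^k (1 - c) + c^k d <= qs + d = q; [h2] and
     [h3] compare the two summands. *)
  rewrite -(ler_pM2l ck) segment_polyS.
  have h1 := ler_wpM2l (ltW q_gt0) bn.
  have h2 : 0 <= (qs - c ^+ k * (1 - c)) * segment_poly n.
    by rewrite mulr_ge0 ?subr_ge0 // ltW.
  have h3 : 0 <= (1 - c ^+ k) * d * segment_poly n.
    by rewrite !mulr_ge0 ?subr_ge0 // ltW.
  rewrite /d in h3 *; nra.
(* Once n >= 1/d, the bound 1 - n d is no longer positive. *)
have [n nd] : exists n : nat, d^-1 <= n%:R.
  by exists (Num.truncn d^-1).+1; rewrite ltW // truncnS_gt.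
have [+ _] := ratio n; rewrite ltNge subr_le0 => /negP; apply.
by rewrite -ler_pdivrMr // mul1r.
Qed.

End segments.

(** * The critical value of the k-fuzz *)

Section critical_value.
Variables (R : realType) (k : nat).
Let qs : R := k%:R ^+ k / k.+1%:R ^+ k.+1.

Let qs_itv : 0 <= qs <= 1.
Proof.
rewrite /qs divr_ge0 ?exprn_ge0 //=.
have /andP[a0 a1] := mode_itv R k.
rewrite -mode_value; set a := _ / _ in a0 a1 *.
by apply: mulr_ile1; rewrite ?exprn_ge0 ?exprn_ile1 //; lra.
Qed.

Lemma p_sh_fin_le (W : {fset int}) (H : graph W) :
  is_subgraph H (kfuzz k) -> p_sh_fin R H <= 1 - qs.
Proof.
move=> Hk; have /andP[qs0 qs1] := qs_itv.
rewrite /p_sh_fin; set E := [set p | _].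
(* An empty [E] has supremum 0 by convention, and [qs <= 1] settles that case. *)
have [->|E0] := eqVneq E set0; first by rewrite sup0 subr_ge0.
apply: ge_sup; first exact/set0P.
move=> p [/andP[p0 p1]]; apply: contraTT; rewrite -!ltNge => qsp.
have [x /andP[ax x1] xq] : exists2 x : R, k%:R / k.+1%:R <= x <= 1 &
    x ^+ k * (1 - x) = 1 - p.
  by apply: unimodal_solution; rewrite -/qs; lra.
rewrite shearer_XiE.
apply: (@indep_poly_gt0 _ _ _ _ _ k val _ _ x); rewrite ?xq ?x1 ?andbT //.
- by rewrite subr_ge0.
- by move=> u v /Hk /andP[].
(* It remains to see that [x] is nonzero. The delicate case is k = 0, whose mode is 0: there [x = 0]
   would give [1 - p = qs], against [qsp]. *)
have /andP[a0 _] := mode_itv R k.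
rewrite lt_neqAle (le_trans a0 ax) andbT; apply: contraTneq qsp => x0.
have := mode_value R k; rewrite -/qs.
have -> : k%:R / k.+1%:R = x by apply/le_anti; rewrite ax -x0.
by rewrite xq; lra.
Qed.

Lemma p_sh_kfuzz : p_sh R (kfuzz k) = 1 - qs.
Proof.
rewrite /p_sh; set E := [set x | _].
have /andP[qs0 qs1] := qs_itv.
have ubE : ubound E (1 - qs) by move=> x [W [H [Hk ->]]]; exact: p_sh_fin_le.
have inE W : E (p_sh_fin R (Defs.induced (kfuzz k) W)).
  by exists W, (Defs.induced (kfuzz k) W); split.
have ub1 W : has_ubound [set p : R | 0 <= p <= 1 /\
    shearer_Xi (Defs.induced (kfuzz k) W) p <= 0].
  by exists 1 => p [/andP[]].
apply/le_anti/andP; split.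
  by apply: ge_sup => //; exists (p_sh_fin R (Defs.induced (kfuzz k) fset0)).
have E_le W : p_sh_fin R (Defs.induced (kfuzz k) W) <= sup E.
  by apply: ub_le_sup; first by exists (1 - qs).
apply/unstable.ler_ltP => p pqs.
(* A negative [p] is outside the range where Xi is tested, so the supremum is bounded below by 0
   instead. *)
have [p0|p0] := ltP p 0.
  apply: le_trans (ltW p0) (le_trans _ (E_le fset0)).
  rewrite /p_sh_fin; set F := [set p | _].
  have [->|/set0P[r Fr]] := eqVneq F set0; first by rewrite sup0.
  apply: le_trans (ub_le_sup (ub1 _) Fr); by case: Fr => /andP[].
have [n bn] := @segment_poly_le0 R k (1 - p) ltac:(rewrite -/qs; lra).
apply: le_trans (E_le (segment n)); apply: ub_le_sup; first exact: ub1.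
by split; [lra | rewrite shearer_XiE].
Qed.

End critical_value.

(** * Moebius inversion on the lattice of subsets *)

(* Expand [\prod_v (F v + H v)], where [F v] is the weight of [v] when [v \in S]
   and [H v] its weight when [v \notin S]. *)
Lemma sum_sign_interval (R : realType) (V : finType) (B C : {set V}) :
  \sum_(S : {set V} | (B \subset S) && (S \subset C)) (-1) ^+ (#|S| - #|B|)
    = (B == C)%:R :> R.
Proof.
pose F v : R := if v \in C then if v \in B then 1 else -1 else 0.
pose H v : R := if v \in B then 0 else 1.
transitivity (\sum_(S : {set V}) \prod_v (if v \in S then F v else H v)).
  rewrite [RHS](bigID (fun S : {set V} => (B \subset S) && (S \subset C))) /=.
  rewrite [X in _ + X]big1 ?addr0 => [|S]; last first.
    rewrite negb_and => /orP[] /fintype.subsetPn[v].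
      by move=> vB /negbTE vS; rewrite (bigD1 v) //= vS /H vB mul0r.
    by move=> vS /negbTE vC; rewrite (bigD1 v) //= vS /F vC mul0r.
  apply: eq_bigr => S /andP[BS SC]; rewrite -(cardsDS BS).
  rewrite (bigID (mem (S :\: B))) /= [X in _ * X]big1 ?mulr1; last first.
    move=> v; rewrite inE negb_and negbK => /orP[vB|vS].
      have vS := fintype.subsetP BS v vB.
      by rewrite vS /F (fintype.subsetP SC v vS) vB.
    rewrite (negbTE vS) /H ifN //; apply: contra vS; exact: (fintype.subsetP BS).
  rewrite (eq_bigr (fun=> -1)) ?prodr_const // => v; rewrite inE => /andP[vB vS].
  by rewrite vS /F (fintype.subsetP SC) // (negbTE vB).
(* The factor [F v + H v] is 0 where [B] and [C] differ and 1 elsewhere. *)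
rewrite -bigA_distr /=; have [BC|] := eqVneq B C.
  by rewrite big1 // => v _; rewrite /F /H BC; case: (v \in C); rewrite ?addr0 ?add0r.
rewrite finset.eqEsubset negb_and => /orP[] /fintype.subsetPn[v].
  by move=> vB vC; rewrite (bigD1 v) //= /F /H (negbTE vC) vB addr0 mul0r.
by move=> vC vB; rewrite (bigD1 v) //= /F /H (negbTE vB) vC addrC subrr mul0r.
Qed.

Definition zeros (V : finType) (y : {ffun V -> bool}) : {set V} :=
  [set v | ~~ y v]%SET.

Lemma zeros_inj (V : finType) : injective (@zeros V).
Proof.
move=> y y' /setP yy'; apply/ffunP => v.
by have := yy' v; rewrite !inE => /negb_inj.
Qed.

(** After exchanging the sums, the coefficient of [Q y'] is the alternating sum over the sets
    between [zeros y] and [zeros y'], which vanishes unless [y' = y]. *)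
Lemma moebius_zeros (R : realType) (V : finType) (Q : {ffun V -> bool} -> R)
    (g : {set V} -> R) :
  (forall S, g S = \sum_(y | S \subset zeros y) Q y) ->
  forall y, \sum_(S : {set V} | zeros y \subset S)
    (-1) ^+ (#|S| - #|zeros y|) * g S = Q y.
Proof.
move=> gE y; under eq_bigr do rewrite gE big_distrr /=.
rewrite (exchange_big_dep predT) //= (bigD1 y) //= [X in _ + X]big1 ?addr0.
  by rewrite -big_distrl /= sum_sign_interval eqxx mul1r.
move=> y' y'y; rewrite -big_distrl /= sum_sign_interval (inj_eq (@zeros_inj V)).
by rewrite eq_sym (negbTE y'y) mul0r.
Qed.

(** * Finite marginals and the laws they determine *)

Definition restr (V : choiceType) (W : {fset V}) (Z : V -> bool) :
    {ffun W -> bool} :=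
  [ffun v => Z (val v)].

Section finite_marginals.
Context d (T : measurableType d) (R : realType) (P : probability T R).

Lemma prob_finE (F : finType) (f : T -> F) (A : {set F}) :
  (forall y, measurable (f @^-1` [set y])) ->
  P [set w | f w \in A] = (\sum_(y in A) fine (P (f @^-1` [set y])))%:E.
Proof.
move=> mf; suff [] : measurable [set w | f w \in A] /\
  P [set w | f w \in A] = (\sum_(y in A) fine (P (f @^-1` [set y])))%:E by [].
have [n] := ubnP #|A|; elim: n A => // n IH A nA.
have [->|/set0Pn[y yA]] := eqVneq A finset.set0.
  rewrite finset.big_set0; have -> : [set w | f w \in finset.set0] = set0.
    by apply/seteqP; split=> w //=; rewrite inE.
  by rewrite measure0.
have [|mA PA] := IH (A :\ y); first by rewrite (cardsD1 y A) yA in nA.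
have AE : [set w | f w \in A] = (f @^-1` [set y]) `|` [set w | f w \in A :\ y].
  apply/seteqP; split=> w /=; rewrite !inE.
    by move=> ->; have [->|] := eqVneq (f w) y; [left|right].
  by case=> [->|/andP[_ ->]].
rewrite AE; split; first exact: measurableU.
rewrite measureU //; last first.
  by apply/seteqP; split=> w //= [->]; rewrite !inE eqxx.
by rewrite [X in (_ + X)%E]PA (finset.big_setD1 y yA) [RHS]EFinD fineK // fin_num_measure.
Qed.

Lemma restr_measurable (V : choiceType) (Z : V -> T -> bool) (W : {fset V})
    (y : {ffun W -> bool}) :
  (forall v, measurable [set w | Z v w = false]) ->
  measurable ((fun w => restr W (Z ^~ w)) @^-1` [set y]).
Proof.
move=> mZ; have -> : (fun w => restr W (Z ^~ w)) @^-1` [set y] =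
    \bigcap_(v in [set: W]) [set w | Z (val v) w = y v].
  apply/seteqP; split=> w /=; first by move=> <- v _ /=; rewrite ffunE.
  by move=> Zy; apply/ffunP => v; rewrite ffunE; exact: Zy.
apply: fin_bigcap_measurable => [|v _]; first exact: finite_finset.
case: (y v) => //.
rewrite (_ : [set w | _] = ~` [set w | Z (val v) w = false]).
  exact: measurableC.
by apply/seteqP; split=> w /=; case: (Z _ w).
Qed.

(** The law of the window and the Shearer mass are both the Moebius inverse of the same function
    [g], the probability of vanishing on a given set. *)
Lemma shearer_marginals_of_zeros (V : choiceType) (G : graph V) (q : R)
    (Z : V -> T -> bool) (W : {fset V}) (A : {set {ffun W -> bool}}) :
  (forall v, measurable [set w | Z v w = false]) ->
  (forall S : {set W},
    P [set w | forall v : W, v \in S -> Z (val v) w = false] =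
    (if independent (Defs.induced G W) S then q ^+ #|S| else 0)%:E) ->
  P [set w | restr W (Z ^~ w) \in A] =
    (shearer_signed_measure (Defs.induced G W) (1 - q) A)%:E.
Proof.
move=> mZ zerosP.
have mr (y : {ffun W -> bool}) := restr_measurable y mZ.
rewrite prob_finE; last exact: mr.
apply/congr1/eq_bigr => y _.
pose Q (y : {ffun W -> bool}) := fine (P ((fun w => restr W (Z ^~ w)) @^-1` [set y])).
pose g (S : {set W}) := if independent (Defs.induced G W) S then q ^+ #|S| else 0.
rewrite -[LHS]/(Q y) -(@moebius_zeros _ _ Q g).
  rewrite /shearer_mass subKr big_mkcondr; apply: eq_bigr => S _.
  by rewrite /g; case: ifP => // _; rewrite mulr0.
move=> S; apply: EFin_inj; rewrite -zerosP.
rewrite (eq_bigl (fun y => y \in [set y | S \subset zeros y]%SET)); last first.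
  by move=> z; rewrite inE.
rewrite -prob_finE; last exact: mr.
congr (P _); apply/seteqP; split => w /=; rewrite inE.
  move=> ZS; apply/fintype.subsetP => v vS.
  by rewrite inE ffunE ZS.
by move=> /fintype.subsetP SZ v /SZ; rewrite inE ffunE => /negbTE.
Qed.

End finite_marginals.

(* The events depending on finitely many coordinates form a pi-system. *)
Lemma eq_finite_marginals (R : realType) (V : choiceType)
    (mu nu : probability (config V) R) :
  (forall (W : {fset V}) (A : {set {ffun W -> bool}}),
    mu [set y | restr W y \in A] = nu [set y | restr W y \in A]) ->
  forall A : set (config V), measurable A -> mu A = nu A.
Proof.
move=> munu A mA.
pose G := [set C : set (config V) | measurable C /\ exists W : {fset V},
  forall y y' : config V, (forall v, v \in W -> y v = y' v) -> C y -> C y'].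
have GT : G setT by split; [exact: measurableT | exists fset0].
apply: (@g_sigma_algebra_measure_unique _ _ _ G _ (fun=> setT)) => //.
- by move=> C [].
- by rewrite bigcup_const.
- move=> C D [mC [WC hC]] [mD [WD hD]]; split; first exact: measurableI.
  exists (WC `|` WD)%fset => y y' yy' [Cy Dy]; split.
    by apply: hC Cy => v vW; apply: yy'; rewrite in_fsetU vW.
  by apply: hD Dy => v vW; apply: yy'; rewrite in_fsetU vW orbT.
- move=> C [mC [W hC]].
  (* Membership in [C] is decided on [W], so [C] is the preimage of its image [B] under
     restriction. *)
  pose B := [set f : {ffun W -> bool} |
    `[< exists2 y : config V, C y & restr W y = f >]]%SET.
  have -> : C = [set y | restr W y \in B].
    apply/seteqP; split=> y /=; rewrite inE; first by move=> Cy; apply/asboolP; exists y.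
    move=> /asboolP[z Cz /ffunP zy]; apply: hC Cz => v vW.
    by have := zy [` vW]%fset; rewrite !ffunE.
  exact: munu.
- by move=> _; apply: le_lt_trans (ltry 1); rewrite probability_le1.
have : (<<s @cylinders V >>) A by [].
apply: smallest_sub; first exact: smallest_sigma_algebra.
move=> C [v [b ->]]; apply: sub_sigma_algebra; split.
  by apply: sub_sigma_algebra; exists v, b.
by exists [fset v]%fset => y y' yy' /= <-; rewrite yy' // inE.
Qed.

(** * The block factor of the Bernoulli sequence *)

Section block_factor.
Context d (T : measurableType d) (R : realType) (P : probability T R).
Variables (k : nat) (xi : R) (X : int -> {RV P >-> bool}) (Z : int -> T -> bool).

(** Turns the real-valued formula into a pattern of bits; [i = 0] is the site [n] itself, the only
    place where [X] must be 0. *)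
Lemma block_factorE (n : int) (w : T) :
  (Z n w)%:R = 1 - (1 - (X n w)%:R)
     * \prod_(1 <= i < k.+1) (X (n - i%:Z) w)%:R :> R ->
  Z n w = false <-> forall i, (i <= k)%N -> X (n - i%:Z) w = (i != 0)%N.
Proof.
have prodE s : \prod_(i <- s) (X (n - i%:Z) w)%:R =
    (all (fun i : nat => X (n - i%:Z) w) s)%:R :> R.
  elim: s => [|i s IH]; first by rewrite big_nil.
  by rewrite big_cons IH /=; case: (X _ w); rewrite ?mul1r ?mul0r.
rewrite prodE => ZE.
have {}ZE : Z n w = X n w ||
    ~~ all (fun i : nat => X (n - i%:Z) w) (index_iota 1 k.+1).
  move: ZE; case: (Z n w); case: (X n w); case: (all _ _) => //= h;
    by exfalso; lra.
rewrite ZE; split=> [|h].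
  move=> /negbT; rewrite negb_or negbK => /andP[/negbTE X0 /allP X1] [|i] ik.
    by rewrite subr0.
  by apply: X1; rewrite mem_index_iota.
have := h 0%N isT; rewrite subr0 => -> /=; apply/negbF/allP => i.
by rewrite mem_index_iota => /andP[i0 ik]; rewrite h //; lia.
Qed.

Hypothesis X_iid : iid_bernoulli X xi.
Hypothesis ZP : forall n w,
  Z n w = false <-> forall i, (i <= k)%N -> X (n - i%:Z) w = (i != 0)%N.

Lemma block_measurable (n : int) : measurable [set w | Z n w = false].
Proof.
have -> : [set w | Z n w = false] =
    \bigcap_(i in `I_k.+1) (X (n - i%:Z) @^-1` [set (i != 0)%N]).
  apply/seteqP; split=> w /=.
    by move=> /ZP h i /= ik; rewrite h.
  by move=> h; apply/ZP => i ik; apply: h.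
apply: fin_bigcap_measurable => // i _.
by rewrite -[X in measurable X]setTI; exact: measurable_funP.
Qed.

Lemma zeros_prob (W : {fset int}) (S : {set W}) :
  P [set w | forall v : W, v \in S -> Z (val v) w = false] =
  (if independent (Defs.induced (kfuzz k) W) S
   then (xi ^+ k * (1 - xi)) ^+ #|S| else 0)%:E.
Proof.
case: X_iid => X_indep PX1.
have PX0 j : P (X j @^-1` [set false]) = (1 - xi)%:E.
  have -> : X j @^-1` [set false] = ~` (X j @^-1` [set true]).
    by apply/seteqP; split=> w /=; case: (X j w).
  rewrite probability_setC ?PX1 //.
  by rewrite -[X in measurable X]setTI; exact: measurable_funP.
case: ifPn => [/forall_inP indS|]; last first.
  rewrite negb_forall_in => /existsP[u /andP[uS]].
  rewrite negb_forall_in => /existsP[v /andP[vS]]; rewrite negbK => uv.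
  suff -> : [set w | forall v : W, v \in S -> Z (val v) w = false] = set0.
    by rewrite measure0.
  wlog lt_uv : u v uS vS uv / val u < val v.
    move=> H; have [lt|gt|eq] := ltgtP (val u) (val v).
    - exact: (H u v).
    - by apply: (H v u) => //; rewrite adj_sym.
    - by move: uv; rewrite /= /kfuzz_adj eq eqxx.
  apply/seteqP; split=> // w /= h.
  (* The site of [u] ends its own block, where [X] is 0, yet lies between 1 and [k] to the left of
     [v], where the block of [v] requires 1. *)
  have /ZP/(_ 0%N isT) := h u uS; rewrite subr0.
  have /ZP/(_ `|val v - val u|%N) := h v vS.
  move: uv lt_uv => /= /andP[_]; move: (fsval u) (fsval v) => m n mnk mn.
  rewrite (_ : n - _ = m); last by lia.
  by move=> -> //; lia.
pose s : seq int := [seq val v | v <- enum S].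
have s_uniq : uniq s by rewrite map_inj_uniq ?enum_uniq //; exact: val_inj.
(* [idx] hides [iota 0 k.+1], which simplification would unfold. *)
have [idx idxE] : exists idx, idx = iota 0 k.+1 by exists (iota 0 k.+1).
have mem_idx i : (i \in idx) = (i < k.+1)%N by rewrite idxE mem_iota.
pose site (n : int) (i : nat) : int := n - i%:Z.
pose js := [seq site n i | n <- s, i <- idx].
have s_sep (n m : int) : n \in s -> m \in s -> n != m -> k%:Z < `|n - m|.
  move=> /mapP[u + ->] /mapP[v + ->]; rewrite !mem_enum => uS vS uv.
  move/forall_inP: (indS u uS) => /(_ v vS).
  by rewrite /= /kfuzz_adj uv /= -ltNge.
have js_uniq : uniq js.
  apply: allpairs_uniq => //; first by rewrite idxE iota_uniq.
  move=> p1 p2 /allpairsP[[n i] /= [ns ik ->]] /allpairsP[[m j] /= [ms jk ->]].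
  rewrite !mem_idx in ik jk; rewrite /= /site => e.
  have nm : n = m by apply/eqP; apply: contraT => /(s_sep _ _ ns ms); lia.
  by congr (_, _) => //; lia.
(* One prescription serves all blocks: 0 on [s] and 1 off it. It is consistent because a block
   starting from a site of [s] meets [s] only there. *)
pose A (j : int) : set bool := [set (j \notin s)].
pose J := [fset j in js]%fset.
have -> : [set w | forall v : W, v \in S -> Z (val v) w = false] =
    \bigcap_(j in [set` J]) X j @^-1` A j.
  have AE n i : n \in s -> (i <= k)%N -> (n - i%:Z \notin s) = (i != 0)%N.
    move=> ns ik; case: i ik => [|i] ik; first by rewrite subr0 ns.
    by apply/negP => /(s_sep _ _ ns); lia.
  apply/seteqP; split=> w /= h.
    move=> j /=; rewrite inE => /allpairsP[[n i] /= [ns + ->]].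
    rewrite mem_idx /A /site /= => ik; rewrite AE //.
    move/mapP: ns => [v vS ->]; rewrite mem_enum in vS.
    by have /ZP -> := h v vS.
  move=> v vS; apply/ZP => i ik.
  have vs : val v \in s by apply/mapP; exists v; rewrite ?mem_enum.
  rewrite -(AE (val v)) //; apply: (h (val v - i%:Z)).
  by rewrite /= inE; apply/allpairsP; exists (val v, i); rewrite mem_idx.
rewrite X_indep // (perm_big js) /=; last first.
  by apply: uniq_perm => //; [exact: fset_uniq | move=> j; rewrite inE].
rewrite (eq_bigr (fun j => (if j \in s then 1 - xi else xi)%:E)); last first.
  by move=> j _; rewrite /A; case: (j \in s); rewrite ?PX0 ?PX1.
rewrite prodEFin; apply: congr1; rewrite big_allpairs_dep /site.
(* Each block contributes [1 - xi] at its zero and [xi] at its [k] other sites. *)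
rewrite (eq_big_seq (fun=> xi ^+ k * (1 - xi))); last first.
  move=> n ns; rewrite idxE /= big_cons subr0 ns mulrC; congr (_ * _).
  rewrite (eq_big_seq (fun=> xi)); last first.
    move=> i; rewrite mem_iota => ik; rewrite ifN //.
    by apply/negP => /(s_sep _ _ ns); lia.
  by rewrite big_const_seq count_predT size_iota -Monoid.iteropE.
by rewrite big_const_seq count_predT size_map -cardE iter_mulr_1.
Qed.

End block_factor.

(** * Shearer's measure as the law of the block factor *)

Lemma path_measurable (V : Type) d (T : measurableType d) (Z : V -> T -> bool) :
  (forall v, measurable [set w | Z v w = false]) ->
  measurable_fun [set: T] ((fun w v => Z v w) : T -> config V).
Proof.
move=> mZ; apply: (@measurability _ _ _ (config V) setT _ (@cylinders V)) => //.
move=> _ [_ [v [b ->]] <-]; rewrite setTI.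
case: b; last exact: mZ.
rewrite (_ : _ @^-1` _ = ~` [set w | Z v w = false]); first exact: measurableC.
by apply/seteqP; split=> w /=; case: (Z v w).
Qed.

Theorem mainTheorem4 (R : realType) (k : nat) :
  p_sh R (kfuzz k) = 1 - k%:R ^+ k / k.+1%:R ^+ k.+1 /\
  forall p : R, 0 <= p <= 1 -> p_sh R (kfuzz k) <= p ->
    exists xi : R,
      [/\ k%:R / k.+1%:R <= xi <= 1 /\ xi ^+ k * (1 - xi) = 1 - p,
          (forall x : R, k%:R / k.+1%:R <= x <= 1 ->
             x ^+ k * (1 - x) = 1 - p -> x = xi)
        & forall (d : measure_display) (T : measurableType d)
                 (P : probability T R) (X : int -> {RV P >-> bool})
                 (Z : int -> T -> bool),
            iid_bernoulli X xi ->
            (forall (n : int) (w : T),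
               (Z n w)%:R = 1 - (1 - (X n w)%:R)
                  * \prod_(1 <= i < k.+1) (X (n - i%:Z) w)%:R :> R) ->
            exists mu : probability (config int) R,
              is_shearer_measure (kfuzz k) p mu /\ has_law P Z mu].
Proof.
split; first exact: p_sh_kfuzz.
move=> p /andP[p0 p1]; rewrite p_sh_kfuzz => psp.
have [xi xi_itv xiq] : exists2 x : R, k%:R / k.+1%:R <= x <= 1 &
    x ^+ k * (1 - x) = 1 - p by apply: unimodal_solution; lra.
exists xi; split=> //.
  move=> x /andP[ax x1] xq; case/andP: xi_itv => axi xi1.
  have [lt|lt|//] := ltgtP x xi.
    by have := unimodal_decreasing ax lt xi1; rewrite xq xiq ltxx.
  by have := unimodal_decreasing axi lt x1; rewrite xq xiq ltxx.
move=> d T P X Z X_iid ZE.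
have ZP n w := block_factorE (ZE n w).
have mZ n := block_measurable ZP n.
have mZpath := path_measurable mZ.
pose Zpath : {mfun T >-> config int} := mfun_Sub (mem_set mZpath).
(* The candidate is the law of [Z] itself, so only its finite marginals and the uniqueness clause
   remain. *)
pose mu : probability (config int) R := distribution P Zpath.
have mu_marg : has_shearer_marginals (kfuzz k) p mu.
  move=> W A; rewrite -[p](subKr 1) -xiq.
  apply: (shearer_marginals_of_zeros (Z := Z)) => // S.
  exact: (zeros_prob X_iid ZP S).
exists mu; split=> //; split=> // nu nu_marg A mA.
by apply: eq_finite_marginals mA => W B; rewrite [LHS]nu_marg [RHS]mu_marg.
Qed.
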